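(* If $\mathcal{C}$ is a complex with $\lambda(\mathcal{C})\le d$ and $\mathcal{S}=(S_1,\ldots,S_{d+k})$ is a family of subsets of $V(\mathcal{C})$ satisfying $\bigcup_{i\in I}S_i\notin\mathcal{C}$ whenever $I\subseteq\{1,\ldots,d+k\}$ is of size $k$, then there exists an $\mathcal{S}$-rainbow set that does not belong to $\mathcal{C}$.
   Context: ''Family'' means multiset: members may repeat. A complex is a closed-down hypergraph, meaning that any subset of any edge (member) is an edge; $V=V(\mathcal{C})$ denotes its ground (vertex) set. $\mathcal{C}[S]$ denotes the subcomplex consisting of the members of $\mathcal{C}$ contained in $S$. A complex $\mathcal{C}$ is $d$-Leray if $\tilde H_j(\mathcal{C}[S])=0$ for all $S\subseteq V$ and all $j\ge d$, where $\tilde H_j$ is the reduced $j$-th homology group. $\lambda(\mathcal{C})$ is the smallest number $d$ such that $\mathcal{C}$ is $d$-Leray. For a family $\mathcal{S}=(S_1,\dots,S_m)$ of sets, an $\mathcal{S}$-rainbow set is the image of a partial choice function of $\mathcal{S}$, i.e. a set $\{x_{i_j}\mid j\le r\}$ where $1\le i_1<\dots<i_r\le m$ and $x_{i_j}\in S_{i_j}$.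
   Formalization: The ground set V(C) is assumed finite; without finiteness the claim fails (C = finite subsets of ℕ, d=0, k=1, S_1=ℕ). Infinite V(C) with finite S_i reduces to the subcomplex on the union of the S_i. Homology is taken over an arbitrary integral domain. *)

(* Defs.v *)
From HB Require Import structures.
From mathcomp Require Import all_boot all_order all_algebra.
From mathcomp Require Import boolp.

Set Implicit Arguments.
Unset Strict Implicit.
Unset Printing Implicit Defensive.

Import GRing.Theory.
Local Open Scope ring_scope.

(* Ground sets are finite types V; a hypergraph on V is a {set {set V}}.
   An element v of V need not be a face ([set v] may fail to be an edge), and
   the empty hypergraph counts as a complex.
   The subcomplex C[S] is finset's C ::&: S. *)
Definition is_complex (V : finType) (C : {set {set V}}) : Prop :=
  forall A B : {set V}, A \in C -> B \subset A -> B \in C.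

Section Homology.
Variables (R : nzRingType) (V : finType).
Implicit Types (X C : {set {set V}}) (n j d : nat).

(* Faces are indexed by cardinality: face X n is the set of faces of dimension
   n - 1, and face X 0 is inhabited exactly when the empty set is a face, so
   that chains on face X 0 give the augmentation term of reduced homology. *)
Definition face X n := {A : {set V} | (A \in X) && (#|A| == n)}.

Definition chain X n := {ffun face X n -> R}.

(* Faces are oriented by the enumeration order of V. The incidence of
   s = {v_0 < ... < v_p} and t is (-1)^i if t = s minus v_i, and 0 if t is not
   a facet of s. *)
Definition position (s : {set V}) (v : V) : nat :=
  #|[set u in s | (enum_rank u < enum_rank v)%N]|.

Definition incidence (s t : {set V}) : R :=
  \sum_(v in s | s :\ v == t) (-1) ^+ position s v.

Definition boundary X n (c : chain X n.+1) : chain X n :=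
  [ffun t : face X n => \sum_(s : face X n.+1) c s * incidence (val s) (val t)].

Fact boundary_is_zmod_morphism X n : zmod_morphism (@boundary X n).
Proof.
move=> a b; apply/ffunP=> t; rewrite !ffunE -sumrB.
by apply: eq_bigr => s _; rewrite !ffunE mulrBl.
Qed.

HB.instance Definition _ X n :=
  GRing.isZmodMorphism.Build (chain X n.+1) (chain X n) (@boundary X n)
    (@boundary_is_zmod_morphism X n).

Lemma position_setD1 (s : {set V}) u v : u \in s ->
  position s v = ((enum_rank u < enum_rank v)%N + position (s :\ u) v)%N.
Proof.
move=> us; rewrite /position (cardsD1 u) inE us /=; congr (_ + _)%N.
by apply: eq_card => x; rewrite !inE andbA.
Qed.

Lemma boundaryK X n (c : chain X n.+2) :
  is_complex X -> boundary (boundary c) = 0.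
Proof.
move=> Xc; apply/ffunP=> t; rewrite !ffunE.
under eq_bigr => s _ do rewrite ffunE mulr_suml.
rewrite exchange_big /= big1 // => w _.
under eq_bigr => s _ do rewrite -mulrA.
rewrite -mulr_sumr.
suff -> : \sum_(s : face X n.+1)
    incidence (val w) (val s) * incidence (val s) (val t) = 0 by rewrite mulr0.
have /andP[wX /eqP cw] := valP w.
transitivity (\sum_(v in val w)
    (-1) ^+ position (val w) v * incidence (val w :\ v) (val t)).
  under eq_bigr => s _ do rewrite {1}/incidence big_mkcondr /= mulr_suml.
  rewrite exchange_big /=; apply: eq_bigr => v vw.
  have fP : (val w :\ v \in X) && (#|val w :\ v| == n.+1).
    rewrite (Xc _ _ wX (subD1set _ _)) /=.
    by move: cw; rewrite (cardsD1 v) vw add1n => -[/eqP].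
  rewrite (bigD1 (exist _ (val w :\ v) fP : face X n.+1)) //= eqxx big1 ?addr0 //.
  move=> s; rewrite -val_eqE /= => /negPf ns.
  by rewrite eq_sym ns mul0r.
pose F v u : R := if [&& u \in val w, v \in val w, u != v &
    val w :\ v :\ u == val t]
  then (-1) ^+ (position (val w) v + position (val w :\ v) u) else 0.
transitivity (\sum_v \sum_u F v u).
  rewrite big_mkcond; apply: eq_bigr => v _ /=; rewrite /F.
  case: ifP => vw; last by rewrite big1 // => u _; rewrite andbF.
  rewrite /incidence mulr_sumr big_mkcond; apply: eq_bigr => u _.
  rewrite !inE exprD /=.
  by case: (u \in _); case: (u != v) => //=; case: (_ == _).
have Fanti u v : (enum_rank u < enum_rank v)%N -> F u v = - F v u.
  move=> uv; have nuv : u != v by apply: contraTneq uv => ->; rewrite ltnn.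
  rewrite /F setDDl setUC -setDDl nuv eq_sym nuv /=.
  case uw: (u \in val w); case vw: (v \in val w); rewrite /= ?oppr0 //.
  case: ifP; rewrite ?oppr0 // => _.
  rewrite (position_setD1 u vw) (position_setD1 v uw) uv.
  by rewrite ltnNge (ltnW uv) /= add0n add1n addSn exprS mulN1r addnC opprK.
have Fdiag v : F v v = 0 by rewrite /F eqxx !andbF.
transitivity (\sum_v \sum_(u | (enum_rank u < enum_rank v)%N) F v u
  + \sum_v \sum_(u | (enum_rank v < enum_rank u)%N) F v u).
  rewrite -big_split /=; apply: eq_bigr => v _.
  rewrite (bigD1 v) //= Fdiag add0r (bigID (fun u => enum_rank u < enum_rank v)%N) /=.
  congr (_ + _); apply: eq_bigl => u.
    by case: eqVneq => [->|] //=; rewrite ltnn.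
  rewrite -leqNgt ltn_neqAle andbC andbC (inj_eq val_inj) (inj_eq enum_rank_inj).
  by rewrite eq_sym.
rewrite [X in _ + X](exchange_big_dep xpredT) //= -big_split big1 //= => v _.
rewrite -big_split big1 //= => u uv; by rewrite (Fanti _ _ uv) subrr.
Qed.

(* Only degrees j >= 0 are needed, so degree j lives on faces of cardinality
   j.+1 and the boundary out of it is always defined. *)
Definition is_cycle X j : {pred chain X j.+1} :=
  fun c => boundary c == 0.

Fact is_cycle_zmod_closed X j : zmod_closed (@is_cycle X j).
Proof.
split=> [|a b]; first by apply/eqP; rewrite raddf0.
move=> /eqP a0 /eqP b0; apply/eqP; rewrite raddfB.
by rewrite /= a0 b0 subrr.
Qed.

HB.instance Definition _ X j :=
  GRing.isZmodClosed.Build (chain X j.+1) (@is_cycle X j)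
    (@is_cycle_zmod_closed X j).

Record cycle_group X j := Cycle {
  cycle_chain :> chain X j.+1;
  cycle_chainP : cycle_chain \in @is_cycle X j }.

HB.instance Definition _ X j := [isSub for @cycle_chain X j].
HB.instance Definition _ X j := [Choice of cycle_group X j by <:].
HB.instance Definition _ X j :=
  [SubChoice_isSubZmodule of cycle_group X j by <:].

Definition is_boundary X j : {pred cycle_group X j} :=
  fun z => `[< exists b : chain X j.+2, boundary b = val z >].

Fact is_boundary_zmod_closed X j : zmod_closed (@is_boundary X j).
Proof.
split=> [|y z]; first by apply/asboolP; exists 0; rewrite !raddf0.
move=> /asboolP[a ay] /asboolP[b bz]; apply/asboolP; exists (a - b).
by rewrite !raddfB /= ay bz.
Qed.

HB.instance Definition _ X j :=
  GRing.isZmodClosed.Build (cycle_group X j) (@is_boundary X j)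
    (@is_boundary_zmod_closed X j).

(* The reduced homology group of X in degree j >= 0, coefficients in R. *)
Definition reduced_homology X j : zmodType :=
  Quotient.quot (@is_boundary X j : zmodClosed (cycle_group X j)).

Definition is_leray C d : Prop :=
  forall (S : {set V}) (j : nat), (d <= j)%N ->
    forall h : reduced_homology (C ::&: S) j, h = 0.

Lemma reduced_homology_trivialP X j :
  (forall h : reduced_homology X j, h = 0) <->
  (forall c : chain X j.+1, boundary c = 0 ->
     exists b : chain X j.+2, boundary b = c).
Proof.
split=> [H c /eqP c0 | H h].
  pose z : cycle_group X j := Cycle c0.
  have /eqP := H (\pi_(reduced_homology X j) z)%qT.
  rewrite -[0](@pi_zeror _ _ _ _ _ (reduced_homology X j)) /= -Quotient.idealrBE.
  by rewrite subr0 unfold_in => /asboolP.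
rewrite -[h]reprK -[0](@pi_zeror _ _ _ _ _ (reduced_homology X j)).
apply/eqP; rewrite -Quotient.idealrBE subr0 unfold_in; apply/asboolP.
by apply: H; apply/eqP; exact: (cycle_chainP (repr h)).
Qed.

Lemma is_leray_card C : is_leray C #|V|.
Proof.
move=> S j lej; apply/reduced_homology_trivialP => c _; exists 0.
apply/ffunP=> -[A AP]; exfalso; have /andP[_ /eqP cA] := AP.
by have := max_card (mem A); rewrite cA leqNgt ltnS lej.
Qed.

Lemma ex_leray C : exists d, `[< is_leray C d >].
Proof. by exists #|V|; apply/asboolP; exact: is_leray_card. Qed.

Definition leray_number C : nat := ex_minn (ex_leray C).

End Homology.

(* f encodes a partial function, undefined where it is None. *)
Definition partial_choice (V : finType) (m : nat) (S : 'I_m -> {set V})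
    (f : 'I_m -> option V) : Prop :=
  forall i x, f i = Some x -> x \in S i.

Definition is_rainbow (V : finType) (m : nat) (S : 'I_m -> {set V})
    (A : {set V}) : Prop :=
  exists2 f : 'I_m -> option V, partial_choice S f &
    A = [set x | [exists i, f i == Some x]].

(* Main.v *)
(* Kalai and Meshulam's theorem for partition matroids, applied to the blow-up of
   C with vertex set U = V * 'I_(d + k): a set of U is a face when its
   projection to V is, and it is colorful when it has at most one vertex (v, i),
   with v in S_i, for each i.  The blow-up is again d-Leray over the fraction
   field K of R.  If every rainbow set is a face, so is every colorful set.  If
   moreover every face s misses vertices of more than d colors, one builds, by
   descending induction on s, operators t_s on the exterior algebra of K^U, of
   degree 0, sending non-faces containing s to sets s + A with A colorful, with
   t_U the projection to the top degree and
     t_s D + D_s t_s = sum_(v notin s) i_v t_(s + v),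
   where i_v is contraction by v, D = sum_v i_v and D_s = sum_(v notin s) i_v.
   The colorful sets disjoint from s are acyclic in low degrees (more than d
   colors), the non-faces containing s in high degrees (d-Leray), and between
   them these cover all degrees.  Multiplying by the wedge operator e_v
   and taking traces gives tr t_s = tr t_(s + v), so tr t_0 = tr t_U = 1.
   But t_0 maps non-faces to colorful sets, which are faces, so tr t_0 = 0. *)
Require Import Defs.
From mathcomp Require Import all_boot all_order all_algebra.
From mathcomp Require boolp.

Set Implicit Arguments.
Unset Strict Implicit.
Unset Printing Implicit Defensive.

Import GRing.Theory.
Local Open Scope ring_scope.

(** * Alternating sums and matrix entries *)

Lemma alternating_sum0 (I : finType) (M : zmodType) (F : I -> I -> M) :
  (forall u v, F u v = - F v u) -> (forall u, F u u = 0) ->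
  \sum_u \sum_v F u v = 0.
Proof.
move=> Fanti Fdiag.
transitivity (\sum_u \sum_(v | (enum_rank v < enum_rank u)%N) F u v
  + \sum_u \sum_(v | (enum_rank u < enum_rank v)%N) F u v).
  rewrite -big_split; apply: eq_bigr => u _ /=.
  rewrite (bigD1 u) //= Fdiag add0r.
  rewrite (bigID (fun v => enum_rank v < enum_rank u)%N) /=.
  congr (_ + _); apply: eq_bigl => v.
    by case: eqVneq => [->|] //=; rewrite ltnn.
  rewrite -leqNgt ltn_neqAle (inj_eq val_inj) (inj_eq enum_rank_inj).
  by rewrite eq_sym.
rewrite [X in _ + X](exchange_big_dep xpredT) //= -big_split big1 //= => u _.
by rewrite -big_split big1 //= => v _; rewrite Fanti addNr.
Qed.

Lemma mulmx_neq0 (K : pzSemiRingType) m n p (A : 'M[K]_(m, n))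
    (B : 'M[K]_(n, p)) i j :
  (A *m B) i j != 0 -> exists k, A i k != 0 /\ B k j != 0.
Proof.
rewrite mxE => AB0.
have [k ABk|AB] := pickP (fun k => A i k * B k j != 0).
  exists k; split; apply: contraNneq ABk => ->; by rewrite ?mul0r ?mulr0.
by case/eqP: AB0; rewrite big1 // => k _; have /negbFE/eqP := AB k.
Qed.

Lemma addr_neq0 (M : nmodType) (x y : M) : x + y != 0 -> x != 0 \/ y != 0.
Proof.
case: (eqVneq x 0) => [->|]; last by left.
by rewrite add0r; right.
Qed.

Lemma mxBE (V : zmodType) m n (A B : 'M[V]_(m, n)) i j :
  (A - B) i j = A i j - B i j.
Proof. by rewrite !mxE. Qed.

(* [pinvmx M] is a generalized inverse, so [1 - pinvmx M *m M] maps into the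
   kernel of [M]. *)
Lemma row_factor (K : fieldType) m n (M : 'M[K]_(m, n)) (z : 'rV[K]_n) :
  (forall x : 'cV_n, M *m x = 0 -> z *m x = 0) ->
  exists y : 'rV_m, z = y *m M.
Proof.
move=> Mz; exists (z *m pinvmx M); apply/eqP; rewrite -subr_eq0 -mulmxA.
rewrite -{1}[z]mulmx1 -mulmxBr; apply/eqP/matrixP => i j.
have : z *m col j (1%:M - pinvmx M *m M) = 0.
  apply: Mz; rewrite colE mulmxA mulmxBr mulmx1 mulmxA mulmxKpV // subrr.
  by rewrite mul0mx.
by rewrite colE mulmxA -colE => /matrixP/(_ i 0); rewrite [LHS]mxE => ->; rewrite !mxE.
Qed.

(** * Contraction and exterior multiplication on the exterior algebra of K^U *)

Section ExteriorAlgebra.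
Variables (K : fieldType) (U : finType) (r : U -> nat).
Hypothesis r_inj : injective r.
Implicit Types (u v w : U) (s A B S : {set U}).

Local Notation N := #|{: {set U}}|.

(* Chains are columns indexed by all subsets of U, operators on them square
   matrices. *)
Definition face_of (i : 'I_N) : {set U} := enum_val i.
Definition index_of A : 'I_N := enum_rank A.

Lemma index_ofK : cancel index_of face_of. Proof. exact: enum_rankK. Qed.
Lemma face_ofK : cancel face_of index_of. Proof. exact: enum_valK. Qed.

(** The order on U comes from an arbitrary injective ranking [r], so that a blow-up can later be
    ordered compatibly with its projection. *)
Definition sgn v A : K := (-1) ^+ #|[set u in A | (r u < r v)%N]|.

(** The column is the input face and the row the output face: [contraction v] removes [v], and its
    transpose [wedge v] adds it. *)
Definition contraction v : 'M[K]_N := \matrix_(i, j)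
  if (v \notin face_of i) && (j == index_of (v |: face_of i))
  then sgn v (face_of i) else 0.

Definition wedge v : 'M[K]_N := \matrix_(i, j)
  if (v \in face_of i) && (j == index_of (face_of i :\ v))
  then sgn v (face_of i) else 0.

Lemma sgn_sqr v A : sgn v A * sgn v A = 1.
Proof. by rewrite -expr2 sqrr_sign. Qed.

Lemma sgn_setU1 u v A : u \notin A ->
  sgn v (u |: A) = (-1) ^+ (r u < r v)%N * sgn v A.
Proof.
move=> uA; rewrite /sgn -exprD; congr (_ ^+ _).
rewrite (cardsD1 u) !inE eqxx /=; congr (_ + _)%N.
apply: eq_card => x; rewrite !inE.
by case: eqVneq => [->|] //=; rewrite (negPf uA).
Qed.

Lemma sgn_setD1 v A : sgn v (A :\ v) = sgn v A.
Proof.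
congr (_ ^+ _); apply: eq_card => x; rewrite !inE.
by case: eqVneq => [->|] //=; rewrite ltnn andbF.
Qed.

Lemma sgn_setU1_id v A : sgn v (v |: A) = sgn v A.
Proof.
congr (_ ^+ _); apply: eq_card => x; rewrite !inE.
by case: eqVneq => [->|] //=; rewrite ltnn andbF.
Qed.

Lemma sgn_anti u v A : u != v -> u \notin A -> v \notin A ->
  sgn v (u |: A) * sgn u (v |: A) = - (sgn u A * sgn v A).
Proof.
move=> nuv uA vA; rewrite !sgn_setU1 //.
have -> : (r u < r v)%N = ~~ (r v < r u)%N.
  rewrite -leqNgt ltn_neqAle; case: eqP => // /r_inj /eqP.
  by rewrite (negPf nuv).
by case: (_ < _)%N => /=; rewrite ?mulN1r ?mul1r ?mulrN ?mulNr mulrC.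
Qed.

Lemma contraction_mul v p (M : 'M[K]_(N, p)) i j :
  (contraction v *m M) i j =
  if v \notin face_of i
  then sgn v (face_of i) * M (index_of (v |: face_of i)) j else 0.
Proof.
rewrite mxE; case: ifP => vi; last first.
  by rewrite big1 // => k _; rewrite mxE vi mul0r.
rewrite (bigD1 (index_of (v |: face_of i))) //= mxE vi eqxx big1 ?addr0 //.
by move=> k /negPf nk; rewrite mxE nk andbF mul0r.
Qed.

Lemma wedge_mul v p (M : 'M[K]_(N, p)) i j :
  (wedge v *m M) i j =
  if v \in face_of i
  then sgn v (face_of i) * M (index_of (face_of i :\ v)) j else 0.
Proof.
rewrite mxE; case: ifP => vi; last first.
  by rewrite big1 // => k _; rewrite mxE vi mul0r.
rewrite (bigD1 (index_of (face_of i :\ v))) //= mxE vi eqxx big1 ?addr0 //.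
by move=> k /negPf nk; rewrite mxE nk andbF mul0r.
Qed.

Lemma contraction_anti u v p (M : 'M[K]_(N, p)) :
  contraction u *m (contraction v *m M) = - (contraction v *m (contraction u *m M)).
Proof.
apply/matrixP => i j; rewrite [RHS]mxE !contraction_mul !index_ofK !inE.
case ui: (u \in _); case vi: (v \in _) => /=; rewrite ?orbT ?orbF /= ?mulr0 ?oppr0 //.
rewrite [v == u]eq_sym; case: (eqVneq u v) => [->|nuv] /=; first by rewrite !mulr0 oppr0.
rewrite !mulrA -mulNr setUCA; congr (_ * _).
have h := sgn_anti nuv (negbT ui) (negbT vi).
have := congr1 (fun t => sgn u (face_of i) * t * sgn u (v |: face_of i)) h.
rewrite mulrA -mulrA sgn_sqr mulr1 => ->.
by rewrite mulrN mulrA sgn_sqr mul1r mulNr.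
Qed.

Lemma contraction_wedge u v p (M : 'M[K]_(N, p)) : u != v ->
  contraction u *m (wedge v *m M) = - (wedge v *m (contraction u *m M)).
Proof.
move=> nuv; apply/matrixP => i j.
rewrite [RHS]mxE !contraction_mul !wedge_mul !contraction_mul !index_ofK !inE.
rewrite eq_sym (negPf nuv) /=.
case ui: (u \in _); case vi: (v \in _) => /=; rewrite ?andbF /= ?mulr0 ?oppr0 //.
have -> : (u |: face_of i) :\ v = u |: (face_of i :\ v).
  by apply/setP => x; rewrite !inE; case: (eqVneq x u) => [->|]; rewrite ?nuv.
rewrite !mulrA -mulNr; congr (_ * _).
rewrite -{1 2}(setD1K vi) -[sgn v (face_of i)]sgn_setD1 setUCA sgn_setU1_id.
by rewrite mulrC sgn_anti ?inE ?ui ?eqxx ?andbF // mulrC.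
Qed.

(** The Clifford relation i_v e_v + e_v i_v = 1: the first summand keeps the faces without [v], the
    second those with [v]. *)
Lemma contraction_wedge_id v p (M : 'M[K]_(N, p)) :
  contraction v *m (wedge v *m M) + wedge v *m (contraction v *m M) = M.
Proof.
apply/matrixP => i j.
rewrite mxE !contraction_mul !wedge_mul !contraction_mul !index_ofK !inE eqxx /=.
case vi: (v \in _) => /=.
  by rewrite add0r mulrA sgn_setD1 sgn_sqr mul1r setD1K // face_ofK.
by rewrite addr0 mulrA sgn_setU1_id sgn_sqr mul1r setU1K ?vi // face_ofK.
Qed.

Lemma contraction_neq0 v i j : contraction v i j != 0 ->
  v \notin face_of i /\ face_of j = v |: face_of i.
Proof.
by rewrite mxE; case: ifP; rewrite ?eqxx // => /andP[? /eqP->]; rewrite index_ofK.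
Qed.

Lemma wedge_neq0 v i j : wedge v i j != 0 ->
  v \in face_of i /\ face_of j = face_of i :\ v.
Proof.
by rewrite mxE; case: ifP; rewrite ?eqxx // => /andP[? /eqP->]; rewrite index_ofK.
Qed.

(* Boundary in the directions outside [s]. *)
Definition bd s : 'M[K]_N := \sum_(v | v \notin s) contraction v.

Lemma bd_mul s p (M : 'M[K]_(N, p)) :
  bd s *m M = \sum_(v | v \notin s) contraction v *m M.
Proof. exact: mulmx_suml. Qed.

Lemma bd_neq0 s i j : bd s i j != 0 ->
  exists v, [/\ v \notin s, v \notin face_of i & face_of j = v |: face_of i].
Proof.
rewrite summxE => b0.
have [v /andP[vs /contraction_neq0[vi ji]]|b] :=
    pickP (fun v => (v \notin s) && (contraction v i j != 0)).
  by exists v.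
case/eqP: b0; rewrite big1 // => v vs.
by have := b v; rewrite vs => /negbFE/eqP.
Qed.

Lemma bd_mulE s p (M : 'M[K]_(N, p)) i j : (bd s *m M) i j =
  \sum_(v | (v \notin s) && (v \notin face_of i))
    sgn v (face_of i) * M (index_of (v |: face_of i)) j.
Proof.
rewrite bd_mul summxE big_mkcondr; apply: eq_bigr => v _.
exact: contraction_mul.
Qed.

Lemma bd_setU1 s v : v \notin s -> bd s = contraction v + bd (v |: s).
Proof.
move=> vs; rewrite /bd (bigD1 v) //=; congr (_ + _); apply: eq_bigl => u.
by rewrite !inE negb_or andbC.
Qed.

Lemma bd_contraction s v p (M : 'M[K]_(N, p)) :
  bd s *m (contraction v *m M) = - (contraction v *m (bd s *m M)).
Proof.
rewrite !bd_mul mulmx_sumr -sumrN; apply: eq_bigr => u _.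
exact: contraction_anti.
Qed.

(** Exterior multiplication by a vertex outside [s] is a contracting homotopy for [bd s]: e_v
    anticommutes with i_u for u <> v, so only i_v e_v + e_v i_v = 1 remains. *)
Lemma bd_wedge s v p (M : 'M[K]_(N, p)) : v \notin s ->
  bd s *m (wedge v *m M) + wedge v *m (bd s *m M) = M.
Proof.
move=> vs; rewrite !bd_mul mulmx_sumr -big_split (bigD1 v) //=.
rewrite contraction_wedge_id big1 ?addr0 // => u /andP[_ uv].
by rewrite contraction_wedge // addNr.
Qed.

(** [contraction_anti] with u = v gives only 2 i_v^2 = 0, which is empty in characteristic 2. *)
Lemma contraction_sqr v p (M : 'M[K]_(N, p)) :
  contraction v *m (contraction v *m M) = 0.
Proof.
apply/matrixP => i j; rewrite !contraction_mul !index_ofK !inE eqxx /= mxE.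
by case: ifP => //; rewrite mulr0.
Qed.

Lemma bd_sqr s p (M : 'M[K]_(N, p)) : bd s *m (bd s *m M) = 0.
Proof.
pose F u v := if (u \notin s) && (v \notin s)
  then contraction u *m (contraction v *m M) else 0.
transitivity (\sum_u \sum_v F u v).
  rewrite bd_mul big_mkcond; apply: eq_bigr => u _ /=; rewrite /F.
  case: (u \notin s) => /=; last by rewrite big1.
  by rewrite bd_mul mulmx_sumr big_mkcond.
apply: alternating_sum0 => u => [v|]; rewrite /F.
  by rewrite andbC; case: ifP; rewrite ?oppr0 // => _; exact: contraction_anti.
by case: ifP => // _; exact: contraction_sqr.
Qed.

(* Reduced homology of X[S] over K vanishes in dimensions j - 1 >= d. *)
Definition acyclic_from d (X : {set {set U}}) := forall S j (c : 'cV[K]_N),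
  (d < j)%N ->
  (forall i o, c i o != 0 ->
     [/\ face_of i \in X, face_of i \subset S & #|face_of i| = j]) ->
  bd set0 *m c = 0 ->
  exists b : 'cV[K]_N,
    (forall i o, b i o != 0 ->
       [/\ face_of i \in X, face_of i \subset S & #|face_of i| = j.+1]) /\
    bd set0 *m b = c.

End ExteriorAlgebra.

(** * Acyclicity of the non-faces containing a given set *)

Section RelativeAcyclicity.
Variables (K : fieldType) (U : finType) (r : U -> nat).
Hypothesis r_inj : injective r.
Variables (d : nat) (X : {set {set U}}).
Hypotheses (X_complex : is_complex X) (X_acyclic : acyclic_from K r d X).

Local Notation N := #|{: {set U}}|.
Local Notation D := (bd K r set0).
Local Notation I := (contraction K r).
Local Notation E := (wedge K r).

(* For s = set0 this is the pair (simplex on S, X).  Adding v to s trades S for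
   S :\ v, as in the exact sequence relating X, X \ v and the link of v. *)
Lemma relative_acyclic n (s S : {set U}) j (q : 'cV[K]_N) :
  #|s| = n -> (n + d.+1 < j)%N ->
  (forall i o, q i o != 0 -> face_of i \subset S /\ #|face_of i| = j) ->
  (forall i o, face_of i \notin X -> s \subset face_of i ->
     face_of i \subset S -> (D *m q) i o = 0) ->
  exists p : 'cV[K]_N,
    (forall i o, p i o != 0 -> face_of i \subset S /\ #|face_of i| = j.+1) /\
    (forall i o, face_of i \notin X -> s \subset face_of i ->
       face_of i \subset S -> (D *m p) i o = q i o).
Proof.
elim: n s S j q => [|n IHn] s S j q.
  move/cards0_eq => ->; rewrite add0n => dj qS Dq.
  have [S0|[v vS]] := set_0Vmem S.
    exists 0; split=> [i o|i o _ _ iS]; first by rewrite mxE eqxx.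
    rewrite mulmx0 mxE; apply/esym/eqP/negPn/negP => /qS[_].
    move: iS; rewrite S0 subset0 => /eqP->; rewrite cards0 => j0.
    by rewrite -j0 in dj.
  (* [D *m q] is a cycle of X[S], so it has a filling [b] there. Then q - b is a cycle of the full
     simplex on S, filled by the cone with apex [v]; on non-faces [b] vanishes. *)
  have [|i o|//|b [bS bDq]] := X_acyclic (S := S) (j := j.-1) (c := D *m q).
  - by rewrite -ltnS prednK // (leq_trans _ dj).
  - move=> Dq0; have [k [/bd_neq0[u [_ ui ki]] /qS[kS kj]]] := mulmx_neq0 Dq0.
    have iS : face_of i \subset S by apply: subset_trans kS; rewrite ki subsetUr.
    split=> //; last by rewrite -kj ki cardsU1 ui.
    by apply: contraNT Dq0 => iX; rewrite Dq ?sub0set.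
  - exact: bd_sqr.
  rewrite prednK in bS; last by rewrite (leq_trans _ dj).
  exists (E v *m (q - b)); split=> [i o|i o iX _ iS].
    move/mulmx_neq0 => [k [/wedge_neq0[vi ki]]].
    have qbS : (q - b) k o != 0 -> face_of k \subset S /\ #|face_of k| = j.
      by rewrite mxE => /addr_neq0[/qS|]; rewrite ?mxE ?oppr_eq0 // => /bS[].
    move/qbS; rewrite ki => -[kS kj]; split; last first.
      by rewrite (cardsD1 v) vi kj.
    by rewrite -(setD1K vi) subUset sub1set vS.
  have /matrixP/(_ i o) := bd_wedge r_inj (q - b) (negbT (in_set0 v)).
  rewrite (mulmxBr D) bDq subrr mulmx0 addr0 => ->.
  rewrite mxE; have /eqP : (- b) i o == 0; last by move->; rewrite addr0.
  by rewrite mxE oppr_eq0; apply: contraNT iX => /bS[].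
move=> sn; have [v vs] : exists v, v \in s by apply/card_gt0P; rewrite sn.
have sn' : #|s :\ v| = n by move: sn; rewrite (cardsD1 v) vs => -[].
move=> jn qS Dq.
have [vS|vS] := boolP (v \in S); last first.
  exists 0; split=> [i o|i o _ si iS]; first by rewrite mxE eqxx.
  by rewrite (subsetP iS) ?(subsetP si) in vS.
(* [a] is the part of [q] through [v], with [v] deleted. It is a relative cycle for [s :\ v] and
   [S :\ v], since adding [v] to a non-face gives a non-face. *)
set a := I v *m q.
have aS i o : a i o != 0 -> face_of i \subset S :\ v /\ #|face_of i| = j.-1.
  move/mulmx_neq0 => [k [/contraction_neq0[vi ki] /qS[kS kj]]]; split.
    by rewrite subsetD1 vi andbT; apply: subset_trans kS; rewrite ki subsetUr.
  by rewrite -kj ki cardsU1 vi.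
have j0 : (0 < j)%N by rewrite (leq_trans _ jn).
have Da : D *m a = - (I v *m (D *m q)) by rewrite bd_contraction.
have jn' : (n + d.+1 < j.-1)%N by rewrite -ltnS prednK.
have [i o iX si iS|p [pS Dp]] := IHn _ (S :\ v) j.-1 a sn' jn' aS.
  rewrite Da mxE contraction_mul; case: ifP => vi; last by rewrite oppr0.
  have qvi : v |: face_of i \subset S -> (D *m q) (index_of (v |: face_of i)) o = 0.
    move=> viS; apply: Dq; rewrite index_ofK //.
      by apply: contra iX => viX; apply: X_complex viX _; rewrite subsetUr.
    by rewrite -(setD1K vs) setUS.
  have [viS|viS] := boolP (v |: face_of i \subset S).
    by rewrite qvi // mulr0 oppr0.
  apply/eqP; rewrite oppr_eq0; apply: contraNT viS => nz.
  have /mulmx_neq0[k [/bd_neq0[u [_ _ ki]] /qS[kS _]]] :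
    (D *m q) (index_of (v |: face_of i)) o != 0.
    by apply: contraNneq nz => ->; rewrite mulr0.
  by apply: subset_trans kS; rewrite ki index_ofK subsetUr.
have p0 i o : v \in face_of i -> p i o = 0.
  move=> vi; apply/eqP/negPn/negP => /pS[/subsetP/(_ v vi)].
  by rewrite !inE eqxx.
(* The part [E v *m a] of [q] through [v] need not be a relative cycle for [s :\ v]. Subtracting the
   filling [p] of [a] makes it one, and changes nothing on faces containing [v]. *)
have [i o|i o iX si iS|w [wS Dw]] := IHn (s :\ v) S j (E v *m a - p) sn' (ltnW jn).
- rewrite mxE => /addr_neq0[/mulmx_neq0[k [/wedge_neq0[vi ki] /aS[]]]|].
    rewrite ki => kS kj; split.
      by rewrite -(setD1K vi) subUset sub1set vS (subset_trans kS) ?subD1set.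
    by rewrite (cardsD1 v) vi kj add1n prednK.
  rewrite mxE oppr_eq0 => /pS[iS ->]; rewrite prednK //; split=> //.
  by apply: subset_trans iS _; rewrite subD1set.
- have -> : D *m (E v *m a - p) = a - E v *m (D *m a) - D *m p.
    rewrite mulmxBr -{2}(bd_wedge r_inj a (negbT (in_set0 v))).
    by rewrite addrK.
  rewrite !mxBE wedge_mul; case: ifP => vi; last first.
    by rewrite subr0 Dp ?subrr // subsetD1 iS vi.
  have -> : (D *m p) i o = 0.
    apply/eqP/negPn/negP => /mulmx_neq0[k [/bd_neq0[u [_ _ ki]]]].
    by rewrite p0 ?eqxx // ki inE vi orbT.
  have -> : a i o = 0 by rewrite contraction_mul vi.
  rewrite Da mxE contraction_mul index_ofK !inE eqxx /= setD1K // face_ofK.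
  have -> : (D *m q) i o = 0.
    by apply: Dq; rewrite // -(setD1K vs) subUset sub1set vi.
  by rewrite mulr0 oppr0 mulr0 !subr0 addr0.
exists w; split=> // i o iX si iS; rewrite Dw // ?(subset_trans (subD1set _ _)) //.
rewrite mxBE wedge_mul (subsetP si) // contraction_mul index_ofK !inE eqxx /=.
rewrite setD1K ?(subsetP si) // face_ofK sgn_setD1 mulrA sgn_sqr mul1r.
by rewrite p0 ?(subsetP si) // subr0.
Qed.

(** Dual of [relative_acyclic]: rows are cochains. By [row_factor] it suffices that [z] kills the
    kernel of the relevant block [M] of D. A kernel element agrees with some [D *m p] on the support
    of [z], and z D = 0. *)
Lemma row_acyclic (s : {set U}) j (z : 'rV[K]_N) : (#|s| + d.+1 < j)%N ->
  (forall o i, z o i != 0 ->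
     [/\ face_of i \notin X, s \subset face_of i & #|face_of i| = j]) ->
  z *m D = 0 ->
  exists b : 'rV[K]_N,
    (forall o i, b o i != 0 ->
       [/\ face_of i \notin X, s \subset face_of i & #|face_of i| = j.-1]) /\
    b *m D = z.
Proof.
move=> sj zP zD.
pose P n (i : 'I_N) :=
  [&& face_of i \notin X, s \subset face_of i & #|face_of i| == n].
have zPj o i : z o i != 0 -> P j i by move=> /zP[? ? /eqP ?]; apply/and3P.
have PD i k : P j.-1 i -> D i k != 0 -> P j k.
  case/and3P=> iX si /eqP ij /bd_neq0[v [_ vi ki]]; apply/and3P; split.
  - by apply: contra iX => kX; apply: X_complex kX _; rewrite ki subsetUr.
  - by apply: subset_trans si _; rewrite ki subsetUr.
  - by rewrite ki cardsU1 vi ij add1n prednK // (leq_trans _ sj).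
pose M : 'M[K]_N := \matrix_(i, k) if P j.-1 i && P j k then D i k else 0.
have [x Mx|y zy] := @row_factor _ _ _ M z; last first.
  exists (\row_i if P j.-1 i then y 0 i else 0); split=> [o i|].
    by rewrite mxE; case: ifP => [/and3P[? ? /eqP]|]; rewrite ?eqxx.
  apply/rowP => k; have [Pk|nPk] := boolP (P j k).
    rewrite zy !mxE; apply: eq_bigr => i _; rewrite !mxE Pk andbT.
    by case: ifP; rewrite ?mul0r ?mulr0.
  have -> : z 0 k = 0 by apply/eqP/negPn/negP => /zPj; exact/negP.
  rewrite mxE big1 // => i _; rewrite mxE; case: ifP => Pi; last exact: mul0r.
  have -> : D i k = 0; last exact: mulr0.
  by apply/eqP/negPn/negP => /(PD _ _ Pi); exact/negP.
pose q : 'cV[K]_N := \col_k if P j k then x k 0 else 0.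
have zq : z *m x = z *m q.
  apply/matrixP => o o'; rewrite !mxE !ord1; apply: eq_bigr => k _; rewrite mxE.
  case: ifP => // nPk; rewrite mulr0; case: (eqVneq (z 0 k) 0) => [->|/zPj].
    exact: mul0r.
  by rewrite nPk.
have [k o|i o iX si _|p [_ Dp]] := relative_acyclic (S := setT) (q := q) erefl sj.
- by rewrite subsetT mxE; case: ifP => [/and3P[_ _ /eqP]|]; rewrite ?eqxx.
- have /colP/(_ i) := Mx; rewrite [in RHS]mxE ord1 => Mxi.
  have [Pi|nPi] := boolP (P j.-1 i).
    rewrite -Mxi !mxE; apply: eq_bigr => k _; rewrite !mxE Pi /=.
    by case: ifP; rewrite ?mul0r ?mulr0.
  apply/eqP/negPn/negP => /mulmx_neq0[k [/bd_neq0[v [_ vi ki]]]].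
  rewrite mxE; case: ifP => [/and3P[_ _ /eqP kj] _|]; last by rewrite eqxx.
  by case/negP: nPi; rewrite /P iX si -kj ki cardsU1 vi /=.
have -> : z *m x = z *m (D *m p).
  rewrite zq; apply/matrixP => o o'; rewrite !mxE; apply: eq_bigr => k _.
  case: (eqVneq (z o k) 0) => [->|/zP[kX sk _]]; first by rewrite !mul0r.
  by rewrite Dp ?subsetT.
by rewrite mulmxA zD mul0mx.
Qed.
End RelativeAcyclicity.

(** * Acyclicity passes to a complex with duplicated vertices *)

Section VertexDuplication.
Variables (K : fieldType) (U V : finType) (rU : U -> nat) (rV : V -> nat).
Hypotheses (rU_inj : injective rU) (rV_inj : injective rV).
Variable f : U -> V.
Hypothesis f_mono : forall u w, (rV (f u) < rV (f w))%N -> (rU u < rU w)%N.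

(** Meant for [f] injective on S, where it inverts the push-forward of chains. No sign occurs
    because [f_mono] makes [f] order-preserving there. *)
Definition pull_chain (S : {set U}) (g : 'cV[K]_#|{: {set V}}|) :
    'cV[K]_#|{: {set U}}| :=
  \col_i if face_of i \subset S then g (index_of (f @: face_of i)) 0 else 0.

Lemma sgn_imset (S A : {set U}) u : {in S &, injective f} -> A \subset S ->
  u \in S -> sgn K rV (f u) (f @: A) = sgn K rU u A.
Proof.
move=> f_inj AS uS; congr (_ ^+ _).
have ltE w : w \in A -> (rU w < rU u)%N = (rV (f w) < rV (f u))%N.
  move=> wA; apply/idP/idP; last exact: f_mono.
  apply: contraTT; rewrite -!leqNgt leq_eqVlt => /orP[/eqP/rV_inj|/f_mono/ltnW //].
  by move=> /f_inj -> //; exact: (subsetP AS).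
rewrite -(card_in_imset (f := f) (D := [set w in A | (rU w < rU u)%N])).
  apply: eq_card => v; rewrite !inE; apply/andP/imsetP.
    by case=> /imsetP[w wA ->] lt; exists w; rewrite // inE wA ltE.
  by case=> w; rewrite inE => /andP[wA lt] ->; rewrite imset_f // -ltE.
move=> w w'; rewrite !inE => /andP[wA _] /andP[w'A _].
by apply: f_inj; exact: (subsetP AS).
Qed.

Lemma bd_pull_chain (S : {set U}) (g : 'cV[K]_#|{: {set V}}|) :
  {in S &, injective f} ->
  (forall i o, g i o != 0 -> face_of i \subset f @: S) ->
  bd K rU set0 *m pull_chain S g = pull_chain S (bd K rV set0 *m g).
Proof.
move=> f_inj gS; apply/matrixP => i o; rewrite [RHS]mxE !bd_mulE.
case: ifP => iS; last first.
  rewrite big1 // => u _; rewrite mxE index_ofK subUset iS andbF.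
  exact: mulr0.
rewrite index_ofK.
transitivity (\sum_(u in S :\: face_of i)
    sgn K rV (f u) (f @: face_of i) * g (index_of (f u |: f @: face_of i)) 0).
  rewrite big_mkcond [RHS]big_mkcond; apply: eq_bigr => u _ /=.
  rewrite !inE /= mxE index_ofK subUset sub1set iS andbT imsetU1.
  case: (u \in face_of i); case: ifP => //= uS; last exact: mulr0.
  by rewrite (sgn_imset f_inj).
rewrite -(big_imset (fun v => sgn K rV v (f @: face_of i) *
    g (index_of (v |: f @: face_of i)) 0)) /=; last first.
  by move=> u w /setDP[uS _] /setDP[wS _]; exact: f_inj.
rewrite big_mkcond [RHS]big_mkcond; apply: eq_bigr => v _ /=; rewrite !inE /=.
have [vi|vi] := boolP (v \in f @: face_of i).
  case: imsetP => // -[u /setDP[uS ui] vu]; case/negP: ui.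
  move: vi; rewrite vu => /imsetP[w wi uw].
  by rewrite (f_inj _ _ uS _ uw) // (subsetP iS).
case: imsetP => //= vS; apply/esym/eqP; rewrite mulf_eq0; apply/orP; right.
apply/negPn/negP => /gS; rewrite index_ofK subUset sub1set => /andP[/imsetP[u uS vu] _].
case: vS; exists u => //; rewrite inE uS andbT.
by apply: contra vi => ui; rewrite vu imset_f.
Qed.

(* If f u = f w, a cycle can be pushed off w, since the link of w is a cone with
   apex u; once f is injective on S, the complexes are isomorphic. *)
Lemma acyclic_preim d (C : {set {set V}}) : is_complex C ->
  acyclic_from K rV d C ->
  acyclic_from K rU d [set A : {set U} | f @: A \in C].
Proof.
move=> C_complex C_acyclic S; have [n] := ubnP #|S|.
elim: n => // n IHn in S *; rewrite ltnS => Sn j c dj cP Dc.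
have [/exists_inP[u uS /exists_inP[w wS /andP[nuw /eqP fuw]]]|f_inj] :=
  boolP [exists u in S, exists w in S, (u != w) && (f u == f w)].
  pose I := contraction K rU; pose E := wedge K rU.
  have fU x y (A : {set U}) : f x = f y -> x \in A -> f @: (y |: A) = f @: A.
    by move=> fxy xA; rewrite imsetU1; apply/setUidPr; rewrite sub1set -fxy imset_f.
  (* Joining [u] to the part of [c] through [w] stays in the complex since f u = f w. Adding the
     boundary of [b1] to [c] replaces [w] by [u] in that part. *)
  pose b1 := E w *m (E u *m (I w *m c)).
  have Db1 : bd K rU set0 *m b1 = E u *m (I w *m c) - E w *m (I w *m c).
    have bdE v M := canRL (addrK _) (bd_wedge (K := K) rU_inj M (negbT (in_set0 v))).
    rewrite bdE; congr (_ - _ *m _); rewrite bdE bd_contraction // Dc.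
    by rewrite mulmx0 oppr0 mulmx0 subr0.
  have b1P i o : b1 i o != 0 -> [/\ face_of i \in [set A : {set U} | f @: A \in C],
      face_of i \subset S & #|face_of i| = j.+1].
    move=> /mulmx_neq0[k [/wedge_neq0[wi ki]]].
    move=> /mulmx_neq0[l [/wedge_neq0[uk lk]]].
    move=> /mulmx_neq0[m [/contraction_neq0[wl ml]] /cP[]].
    have -> : face_of m = face_of i :\ u.
      rewrite ml lk ki; apply/setP => x; rewrite !inE.
      by case: (eqVneq x w) => [->|]; rewrite ?wi ?andbT // eq_sym nuw.
    have ui : u \in face_of i by move: uk; rewrite ki => /setD1P[].
    rewrite !inE => iC iS <-; split; last by rewrite [LHS](cardsD1 u) ui.
      by rewrite -(setD1K ui) (fU w) // !inE wi eq_sym nuw.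
    by rewrite -(setD1K ui) subUset sub1set uS.
  have cD : c + bd K rU set0 *m b1 = I w *m (E w *m c) + E u *m (I w *m c).
    rewrite Db1 -{1}(contraction_wedge_id rU w c) -!/(I _) -!/(E _).
    by rewrite addrACA addrN addr0.
  have [|i o||b' [b'P Db']] := IHn (S :\ w) _ j (c + bd K rU set0 *m b1) dj.
  - by move: Sn; rewrite (cardsD1 w S) wS.
  - rewrite cD mxE => /addr_neq0[]/mulmx_neq0[k []].
      move=> /contraction_neq0[wi ki] /mulmx_neq0[l [/wedge_neq0[_ lk] /cP[]]].
      by rewrite lk ki setU1K // => ? ? ?; rewrite subsetD1 wi andbT.
    move=> /wedge_neq0[ui ki] /mulmx_neq0[l [/contraction_neq0[wk lk] /cP[]]].
    have wi : w \notin face_of i.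
      by move: wk; rewrite ki !inE eq_sym nuw.
    rewrite lk ki !inE => iC iS <-; split.
    + by rewrite -(setD1K ui) imsetU1 fuw -imsetU1.
    + rewrite subsetD1 wi andbT -(setD1K ui) subUset sub1set uS.
      by apply: subset_trans iS; rewrite subsetUr.
    + by rewrite (cardsD1 u) ui cardsU1 !inE eq_sym nuw wi.
  - by rewrite mulmxDr Dc bd_sqr // addr0.
  exists (b' - b1); split=> [i o|].
    rewrite mxBE => /addr_neq0[/b'P[? iS ?]|]; last by rewrite oppr_eq0; exact: b1P.
    by split=> //; apply: subset_trans iS (subD1set _ _).
  by rewrite mulmxBr Db' addrK.
have {}f_inj : {in S &, injective f}.
  move=> u w uS wS fuw; apply/eqP; apply: contraNT f_inj => nuw.
  by apply/exists_inP; exists u => //; apply/exists_inP; exists w; rewrite ?nuw ?fuw ?eqxx.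
have imK (A : {set V}) : A \subset f @: S -> f @: (S :&: f @^-1: A) = A.
  move=> AS; apply/setP => v; apply/imsetP/idP => [[u]|vA].
    by rewrite !inE => /andP[_ ?] ->.
  have /imsetP[u uS vu] := subsetP AS v vA.
  by exists u; rewrite // !inE uS -vu.
have preK (A : {set U}) : A \subset S -> S :&: f @^-1: (f @: A) = A.
  move=> AS; apply/setP => u; rewrite !inE; apply/andP/idP => [[uS]|uA].
    by case/imsetP=> w wA /f_inj -> //; exact: (subsetP AS).
  by rewrite (subsetP AS) // imset_f.
(* [c] transported along the bijection from S to f @: S. *)
pose g : 'cV[K]_#|{: {set V}}| := \col_i
  if face_of i \subset f @: S then c (index_of (S :&: f @^-1: face_of i)) 0 else 0.
have cg : pull_chain S g = c.
  apply/colP => i; rewrite mxE; case: ifP => iS.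
    by rewrite mxE index_ofK imsetS // preK // face_ofK.
  by apply/esym/eqP; apply: contraFT iS => /cP[].
have gP i o : g i o != 0 ->
    [/\ face_of i \in C, face_of i \subset f @: S & #|face_of i| = j].
  rewrite mxE; case: ifP; rewrite ?eqxx // => iS /cP[]; rewrite index_ofK inE imK //.
  move=> iC _ <-; split=> //; rewrite -{1}(imK _ iS) card_in_imset //.
  by move=> a b; rewrite !inE => /andP[aS _] /andP[bS _]; exact: f_inj.
have Dg : bd K rV set0 *m g = 0.
  apply/matrixP => i o; rewrite [RHS]mxE; apply/eqP/negPn/negP => Dg0.
  have iS : face_of i \subset f @: S.
    have [k [/bd_neq0[v [_ _ ki]] /gP[_ kS _]]] := mulmx_neq0 Dg0.
    by apply: subset_trans kS; rewrite ki subsetUr.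
  case/eqP: Dg0; rewrite ord1; move: Dc; rewrite -cg bd_pull_chain //;
    last by move=> ? ? /gP[].
  move=> /colP/(_ (index_of (S :&: f @^-1: face_of i))).
  by rewrite [LHS]mxE index_ofK subsetIl imK // face_ofK [RHS]mxE.
have [h [hP Dh]] := C_acyclic _ _ _ dj gP Dg.
exists (pull_chain S h); split; last by rewrite bd_pull_chain ?Dh // => ? ? /hP[].
move=> i o; rewrite mxE; case: ifP; rewrite ?eqxx // => iS /hP[].
rewrite index_ofK inE => iC _ <-; split=> //; rewrite card_in_imset //.
by move=> a b ai bi; apply: f_inj; exact: (subsetP iS).
Qed.

End VertexDuplication.

(** * From homology over a domain to chains over its fraction field *)

Section LerayChains.
Variable R : idomainType.
Local Notation K := {fraction R}.
Local Notation "x %:F" := (@FracField.tofrac R x).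

Lemma fraction_numden (x : K) : exists n d : R, d != 0 /\ x * d%:F = n%:F.
Proof.
elim/quotW: x => y; exists (frac y).1, (frac y).2; split; first exact: denom_ratioP.
unlock FracField.tofrac; rewrite -[LHS]FracField.pi_mul.
apply/eqmodP => /=; rewrite FracField.equivfE.
rewrite /FracField.mulf !numden_Ratio ?oner_neq0 ?mulf_neq0 ?denom_ratioP //.
  by rewrite !mulr1 mulrC.
all: exact: oner_neq0.
Qed.

Lemma common_denominator (I : finType) (x : I -> K) :
  exists d : R, d != 0 /\ exists n : I -> R, forall i, x i * d%:F = (n i)%:F.
Proof.
have [n /fin_all_exists[d nd]] := fin_all_exists (fun i => fraction_numden (x i)).
exists (\prod_i d i); split; first by apply/prodf_neq0 => i _; case: (nd i).
exists (fun i => n i * \prod_(k | k != i) d k) => i.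
by rewrite (bigD1 i) //= !rmorphM mulrA; case: (nd i) => _ ->.
Qed.

Variables (V : finType) (C : {set {set V}}) (d : nat).
Local Notation rk := (fun v : V => nat_of_ord (enum_rank v)).

(** Here [e] is defined on all sets and vanishes off the faces, so that chains on a face type and
    columns over K share their coefficients. The two sign conventions agree because [v] does not
    count towards its own position. *)
Lemma boundaryE (X : {set {set V}}) m (e : {set V} -> R) (t : face X m) :
  (forall A, e A != 0 -> (A \in X) && (#|A| == m.+1)) ->
  (boundary [ffun s : face X m.+1 => e (val s)] t)%:F =
  (bd K rk set0 *m \col_i (e (face_of i))%:F) (index_of (val t)) 0.
Proof.
move=> eX; rewrite bd_mulE ffunE rmorph_sum /= index_ofK.
under eq_bigr => s _ do rewrite ffunE rmorphM /= /incidence rmorph_sum mulr_sumr.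
rewrite (exchange_big_dep xpredT) //= [RHS]big_mkcond; apply: eq_bigr => v _.
rewrite !inE /= mxE index_ofK.
have [vt|vt] := boolP (v \in val t) => /=.
  rewrite big1 // => s /andP[_ /eqP st].
  by move: vt; rewrite [val t](esym (st : val s :\ v = val t)) !inE eqxx.
have [e0|/eX es] := eqVneq (e (v |: val t)) 0.
  rewrite e0 rmorph0 mulr0 big1 // => s /andP[vs /eqP st].
  have -> : val s = v |: val t by rewrite -[val t]st setD1K.
  by rewrite e0 rmorph0 mul0r.
rewrite (big_pred1 (exist _ (v |: val t) es : face X m.+1)) => [|s] /=.
  by rewrite mulrC rmorphXn /= rmorphN1 -/(sgn K rk v (v |: val t)) sgn_setU1_id.
rewrite -val_eqE /=; apply/andP/eqP => [[vs /eqP st]|->]; last by rewrite setU11 setU1K.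
by apply/val_inj; rewrite /= -(setD1K vs); congr (_ |: _); exact: val_inj st.
Qed.

(** Multiplying a cycle over K by a common denominator [q] gives a cycle over R; a filling over R
    divided by [q] fills the original one. *)
Lemma leray_acyclic : is_complex C -> is_leray R C d -> acyclic_from K rk d C.
Proof.
(* Faces of cardinality j.+1 carry homology in degree j, so d < j.+1 is the range of the Leray
   condition. *)
move=> C_complex C_leray S [//|j] c dj cP Dc.
have [q [q0 [n cn]]] := common_denominator (fun i => c i 0).
pose X := C ::&: S; pose e A := n (index_of A).
have eX A : e A != 0 -> (A \in X) && (#|A| == j.+1).
  rewrite -tofrac_eq0 -cn mulf_eq0 tofrac_eq0 (negPf q0) orbF => /cP[].
  by rewrite index_ofK inE => -> -> ->; rewrite eqxx.
have ec : \col_i (e (face_of i))%:F = q%:F *: c.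
  by apply/colP => i; rewrite !mxE /e face_ofK -cn mulrC.
have [|b /ffunP Db] := (reduced_homology_trivialP R X j).1 (C_leray S j dj)
    [ffun s : face X j.+1 => e (val s)].
  apply/ffunP => t; rewrite [RHS]ffunE; apply/eqP; rewrite -tofrac_eq0 boundaryE // ec.
  by rewrite -scalemxAr Dc scaler0 !mxE.
pose h A := if insub A is Some s then b (s : face X j.+2) else 0.
have hX A : h A != 0 -> (A \in X) && (#|A| == j.+2).
  by rewrite /h; case: insubP; rewrite ?eqxx.
have bh : b = [ffun s : face X j.+2 => h (val s)].
  by apply/ffunP => s; rewrite ffunE /h valK.
exists (\col_i ((h (face_of i))%:F / q%:F)); split=> [i o|].
  rewrite mxE mulf_eq0 negb_or tofrac_eq0 => /andP[/hX].
  by rewrite !inE => /andP[/andP[-> ->] /eqP ->].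
have -> : \col_i ((h (face_of i))%:F / q%:F) =
    q%:F^-1 *: (\col_i (h (face_of i))%:F) :> 'cV[K]__.
  by apply/colP => i; rewrite !mxE mulrC.
rewrite -scalemxAr; apply: (canLR (scalerK _)); first by rewrite tofrac_eq0.
rewrite -ec; apply/colP => i; rewrite [RHS]mxE.
have [iX|niX] := boolP ((face_of i \in X) && (#|face_of i| == j.+1)).
  pose t : face X j.+1 := exist _ (face_of i) iX.
  have := Db t; rewrite [in RHS]ffunE /= => /(congr1 (@FracField.tofrac R)).
  by rewrite bh boundaryE //= face_ofK.
have -> : e (face_of i) = 0 by apply/eqP/negPn/negP => /eX; exact/negP.
rewrite rmorph0; apply/eqP/negPn/negP => /mulmx_neq0[k [/bd_neq0[v [_ vi ki]]]].
rewrite mxE tofrac_eq0 => /hX; rewrite ki !inE cardsU1 vi eqSS subUset.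
move=> /andP[/andP[vC /andP[_ iS]] ij]; case/negP: niX.
rewrite ij andbT inE iS andbT; apply: C_complex vC _; exact: subsetUr.
Qed.
End LerayChains.

(** * Construction of the operators t_s and comparison of their traces *)

Section Resolution.
Variables (K : fieldType) (U : finType) (r : U -> nat).
Hypothesis r_inj : injective r.
Variables (d : nat) (X : {set {set U}}).
Hypotheses (X_complex : is_complex X) (X_acyclic : acyclic_from K r d X).
Variables (I : finType) (col : U -> I) (G : {set U}).

Implicit Types (A B s : {set U}).

Local Notation N := #|{: {set U}}|.
Implicit Types (M z t : 'M[K]_N).
Local Notation D := (bd K r set0).
Local Notation i_ := (contraction K r).
Local Notation e_ := (wedge K r).

Definition colorful (A : {set U}) := (A \subset G) && (#|col @: A| == #|A|).

Hypothesis colorfulX : forall A, colorful A -> A \in X.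
Hypothesis many_colors :
  forall s, s \in X -> (d < #|col @: (G :\: s)|)%N.

Lemma colorful_sub A B : colorful A -> B \subset A -> colorful B.
Proof.
case/andP=> AG /imset_injP Ainj BA; rewrite /colorful (subset_trans BA) //=.
by apply/imset_injP => x y xB yB; apply: Ainj; exact: (subsetP BA).
Qed.

Lemma colorfulU1 w A : colorful A -> w \in G -> col w \notin col @: A ->
  colorful (w |: A).
Proof.
case/andP=> AG /eqP Ac wG wA; rewrite /colorful subUset sub1set wG AG /=.
rewrite imsetU1 !cardsU1 wA Ac.
by have -> : w \notin A by apply: contra wA; exact: imset_f.
Qed.

(** Columns are inputs and rows outputs; [e] is the drop in cardinality, 0 for t_s and 1 for both
    sides of its equation. *)
Definition carried e (s : {set U}) (M : 'M[K]_N) := forall i j, M i j != 0 ->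
  [/\ s \subset face_of i, colorful (face_of i :\: s), face_of j \notin X,
      s \subset face_of j & (#|face_of i| + e)%N = #|face_of j|].

Lemma carriedD e s M M' : carried e s M -> carried e s M' -> carried e s (M + M').
Proof. by move=> hA hB i j; rewrite mxE => /addr_neq0[/hA|/hB]. Qed.

Lemma carriedN e s M : carried e s M -> carried e s (- M).
Proof. by move=> hA i j; rewrite mxE oppr_eq0; exact: hA. Qed.

Lemma carried0 e s : carried e s 0.
Proof. by move=> i j; rewrite mxE eqxx. Qed.

Lemma carried_bdl e s M : carried e s M -> carried e.+1 s (bd K r s *m M).
Proof.
move=> hA i j /mulmx_neq0[k [/bd_neq0[v [vs vi ki]] /hA[]]].
rewrite ki => sk kc jX sj kj; split=> //.
- apply/subsetP => x xs; have := subsetP sk x xs.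
  by rewrite !inE => /predU1P[xv|//]; rewrite -xv xs in vs.
- by apply: colorful_sub kc _; rewrite setSD ?subsetUr.
- by rewrite -kj cardsU1 vi addnS add1n.
Qed.

Lemma carried_bdr e s M : carried e s M -> carried e.+1 s (M *m D).
Proof.
move=> hA i j /mulmx_neq0[k [/hA[si ic kX sk ik] /bd_neq0[v [_ vk jk]]]].
split=> //; rewrite jk.
- by apply: contra kX => jX; apply: X_complex jX _; rewrite subsetUr.
- by apply: subset_trans sk _; rewrite subsetUr.
- by rewrite cardsU1 vk -ik addnS add1n.
Qed.

(* What remains of the equation [t *m D + bd s *m t = z] after a trial
   solution t. *)
Definition defect s z t : 'M[K]_N := z - t *m D - bd K r s *m t.

Lemma carried_defect s z t : carried 1 s z -> carried 0 s t ->
  carried 1 s (defect s z t).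
Proof.
move=> hz ht; apply: carriedD; last exact/carriedN/carried_bdl.
by apply: carriedD => //; exact/carriedN/carried_bdr.
Qed.

(** The hypothesis is the compatibility condition for solving t D + bd_s t = z. It survives any
    trial [t] because D and [bd s] square to zero. *)
Lemma defect_cycle s z t : z *m D = bd K r s *m z ->
  defect s z t *m D = bd K r s *m defect s z t.
Proof.
move=> hz; rewrite /defect !mulmxBl !mulmxBr bd_sqr // subr0 hz.
rewrite -(mulmxA t D D) -[D *m D]mulmx1 -mulmxA bd_sqr // mulmx0 subr0.
by rewrite mulmxA.
Qed.

Lemma defectD s z t t' : defect s z (t + t') = defect s (defect s z t) t'.
Proof.
rewrite /defect mulmxDl mulmxDr !opprD !addrA; congr (_ - _).
by rewrite -!addrA; congr (_ + (_ + _)); rewrite addrC.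
Qed.

(* Removes the rows of top cardinality first, down to dimension d. *)
Lemma reduce_card n s z : carried 1 s z -> z *m D = bd K r s *m z ->
  (forall i j, z i j != 0 -> (#|face_of i| < #|s| + n)%N) ->
  exists t, carried 0 s t /\
    forall i j, defect s z t i j != 0 -> (#|face_of i| <= #|s| + d)%N.
Proof.
elim: n z => [|n IHn] z hz zD zn.
  exists 0; split; first exact: carried0.
  move=> i j; rewrite /defect mul0mx mulmx0 !subr0 => /zn.
  by rewrite addn0 => /ltnW h; apply: leq_trans h (leq_addr _ _).
have [nd|dn] := leqP n d.
  exists 0; split; first exact: carried0.
  move=> i j; rewrite /defect mul0mx mulmx0 !subr0 => /zn.
  by rewrite addnS ltnS => h; apply: leq_trans h _; rewrite leq_add2l.
(* A row of [bd s *m z] over a face of the top cardinality #|s| + n involves only rows of [z] over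
   larger faces, which vanish. Such rows of [z] are therefore cocycles, and d < n puts them in the
   range of [row_acyclic]. *)
have row_sol i : exists b : 'rV[K]_N,
    (forall o j, b o j != 0 ->
      [/\ s \subset face_of i, colorful (face_of i :\: s), face_of j \notin X,
        s \subset face_of j &
          (#|face_of i| = #|s| + n)%N /\ #|face_of i| = #|face_of j|])
    /\ (#|face_of i| = (#|s| + n)%N -> b *m D = row i z).
  have [z0|zi] := eqVneq (row i z) 0.
    by exists 0; split=> [o j|_]; rewrite ?mxE ?eqxx // mul0mx z0.
  have [j zij] : exists j, z i j != 0.
    apply/existsP; apply: contraNT zi => /existsPn zi; apply/eqP/rowP => j.
    by rewrite !mxE; apply/eqP/negPn/zi.
  have [si ic _ _ _] := hz _ _ zij.
  have [ni|ni] := eqVneq #|face_of i| (#|s| + n)%N; last first.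
    by exists 0; split=> [o k|ni']; [rewrite mxE eqxx|rewrite ni' eqxx in ni].
  have [|o k||b [bP bD]] := row_acyclic r_inj X_complex X_acyclic (s := s)
    (j := (#|s| + n).+1) (z := row i z).
  - by rewrite ltnS addnS ltn_add2l.
  - by rewrite mxE => /hz[_ _ kX sk ik]; split=> //; rewrite -ik ni addn1.
  - rewrite -row_mul zD; apply/rowP => k; rewrite [LHS]mxE [RHS]mxE.
    apply/eqP/negPn/negP => /mulmx_neq0[l [/bd_neq0[v [_ vi li]] /zn]].
    by rewrite li cardsU1 vi ni add1n addnS ltnn.
  exists b; split=> // o k /bP[kX sk kn]; split=> //.
  by rewrite ni kn.
have [b bP] := fin_all_exists row_sol.
pose t1 : 'M[K]_N := \matrix_(i, j) b i 0 j.
have ht1 : carried 0 s t1.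
  move=> i j; rewrite mxE => /(proj1 (bP i))[? ? ? ? [_ ij]].
  by rewrite addn0.
have t1D i j : #|face_of i| = (#|s| + n)%N -> (t1 *m D) i j = z i j.
  move=> /(proj2 (bP i))/rowP/(_ j); rewrite [RHS]mxE => <-.
  by rewrite !mxE; apply: eq_bigr => k _; rewrite mxE.
have [||i j|t2 [ht2 t2P]] := IHn (defect s z t1).
- exact: carried_defect.
- exact: defect_cycle.
- have t1n k l : t1 k l != 0 -> #|face_of k| = (#|s| + n)%N.
    by rewrite mxE => /(proj1 (bP k))[_ _ _ _ []].
  rewrite /defect mxBE => /addr_neq0[|]; last first.
    rewrite oppr_eq0 => /mulmx_neq0[k [/bd_neq0[v [_ vi ki]] /t1n]].
    by rewrite ki cardsU1 vi add1n => <-.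
  rewrite mxBE; have [/t1D->|ni] := eqVneq #|face_of i| (#|s| + n)%N.
    by rewrite subrr eqxx.
  case/addr_neq0 => [/zn|]; first by rewrite addnS ltnS leq_eqVlt (negPf ni).
  by rewrite oppr_eq0 => /mulmx_neq0[k [/t1n /eqP]]; rewrite (negPf ni).
exists (t1 + t2); split; first exact: carriedD.
by rewrite defectD.
Qed.

(* With P the projection onto the span of the colorful sets, the trial solution
   t = P e_w z leaves the defect P (bd s) (1 - P) e_w z. *)
Lemma reduce_color s z w : carried 1 s z -> z *m D = bd K r s *m z ->
  w \in G :\: s ->
  exists t, carried 0 s t /\
    forall i j, defect s z t i j != 0 ->
      exists k, [/\ z k j != 0, #|face_of i| = #|face_of k|,
        col w \in col @: (face_of i :\: s) &
        col @: (face_of k :\: s) \subset col @: (face_of i :\: s)].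
Proof.
move=> hz zD /setDP[wG ws].
pose ok (i : 'I_N) := (s \subset face_of i) && colorful (face_of i :\: s).
pose P : 'M[K]_N := diag_mx (\row_i (ok i)%:R).
have PE p (M : 'M[K]_(N, p)) i j : (P *m M) i j = if ok i then M i j else 0.
  by rewrite mul_diag_mx !mxE; case: (ok i); rewrite ?mul1r ?mul0r.
have Pid M e : carried e s M -> P *m M = M.
  move=> hM; apply/matrixP => i j; rewrite PE; case: ifP => // /negP nok.
  by apply/esym/eqP/negPn/negP => /hM[si ic _ _ _]; case: nok; apply/andP.
pose t := P *m (e_ w *m z).
have ht : carried 0 s t.
  move=> i j; rewrite PE; case: ifP; rewrite ?eqxx // => /andP[si ic].
  move=> /mulmx_neq0[k [/wedge_neq0[wi ki] /hz[_ _ jX sj kj]]]; split=> //.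
  by rewrite -kj ki (cardsD1 w (face_of i)) wi addn0 addnC.
exists t; split=> // i j.
have -> : defect s z t = P *m (bd K r s *m (e_ w *m z - t)).
  rewrite mulmxBr mulmxBr (Pid _ _ (carried_bdl ht)) /defect; congr (_ - _).
  rewrite -[X in P *m X](addrK (e_ w *m (bd K r s *m z))) bd_wedge //.
  by rewrite mulmxBr (Pid _ _ hz) -zD /t !mulmxA.
rewrite PE; case: ifP; rewrite ?eqxx // => /andP[si ic].
move=> /mulmx_neq0[k [/bd_neq0[v [vs vi ki]]]].
rewrite mxBE PE; case: ifPn => [_|nk]; first by rewrite subrr eqxx.
rewrite subr0 => /mulmx_neq0[l [/wedge_neq0[wk lk] zlj]].
have [sl lc jX sj _] := hz _ _ zlj.
have wl : w \notin face_of l by rewrite lk !inE eqxx.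
have kE : face_of k = w |: face_of l by rewrite lk setD1K.
(* [k] fails to be colorful, so the color of [w] already occurs in [l]. *)
have [x xl xw] : exists2 x, x \in face_of l :\: s & col w = col x.
  apply/imsetP; apply: contraNT nk => nw; rewrite /ok kE.
  rewrite (subset_trans sl) ?subsetUr //=.
  have -> : (w |: face_of l) :\: s = w |: (face_of l :\: s).
    by rewrite setDUl; congr (_ :|: _); apply/setDidPl; rewrite disjoints1.
  exact: colorfulU1.
exists l; have il : #|face_of i| = #|face_of l|.
  by have := cardsU1 v (face_of i); rewrite vi -ki kE cardsU1 wl !add1n => -[].
have wi_cases : (v == w) || (w \in face_of i).
  by have : w \in face_of k by []; rewrite ki !inE eq_sym.
have [vw|nvw] := eqVneq v w.
  have -> : face_of i = face_of l by rewrite lk ki vw setU1K // -vw.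
  by split=> //; rewrite xw imset_f.
have wi : w \in face_of i :\: s by move: wi_cases; rewrite (negPf nvw) !inE ws.
have lsub y : y \in face_of l -> y != v -> y \in face_of i.
  by move=> yl; have : y \in face_of k by [rewrite kE !inE yl orbT];
    rewrite ki !inE => /orP[->|].
(* Otherwise the colorful face [i] would contain both [x] and [w], of the same color. Hence [i]
   arises from [l] by exchanging [x] for [w]. *)
have xv : x = v.
  apply/eqP/negPn/negP => nxv; have /andP[_ /imset_injP inj] := ic.
  have xi : x \in face_of i :\: s.
    by move: xl; rewrite !inE => /andP[-> /lsub]; exact.
  by case/setDP: xl; rewrite (inj _ _ xi wi (esym xw)) (negPf wl).
split=> //; first exact: imset_f.
apply/subsetP => _ /imsetP[y yl ->]; have [->|nyv] := eqVneq y v.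
  by rewrite -xv -xw imset_f.
by apply: imset_f; move: yl; rewrite !inE => /andP[-> /lsub]; exact.
Qed.

(** One vertex is treated at a time; colors already forced persist by the inclusion of color sets in
    [reduce_color]. *)
Lemma reduce_colors s z (ws : seq U) :
  carried 1 s z -> z *m D = bd K r s *m z -> {subset ws <= G :\: s} ->
  exists t, carried 0 s t /\
    forall i j, defect s z t i j != 0 ->
      (exists2 k, z k j != 0 & #|face_of i| = #|face_of k|) /\
      {in ws, forall w, col w \in col @: (face_of i :\: s)}.
Proof.
move=> hz zD; elim: ws => [|w ws IHws] wsG.
  exists 0; split; first exact: carried0.
  move=> i j; rewrite /defect mul0mx mulmx0 !subr0 => zij.
  by split=> //; exists i.
have [|t [ht tP]] := IHws.
  by move=> x xs; apply: wsG; rewrite inE xs orbT.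
have [|||t' [ht' t'P]] := @reduce_color s (defect s z t) w.
- exact: carried_defect.
- exact: defect_cycle.
- by apply: wsG; rewrite inE eqxx.
exists (t + t'); split; first exact: carriedD.
move=> i j; rewrite defectD => /t'P[k [/tP[[l zl kl] kws] ik wi ki]].
split; first by exists l; rewrite // ik.
by move=> x; rewrite inE => /predU1P[->//|/kws]; exact: (subsetP ki).
Qed.

(** A row surviving both reductions would have at most d vertices outside [s], yet show all of the
    more than d colors of G :\: s. *)
Lemma solve_face s z : s \in X -> carried 1 s z -> z *m D = bd K r s *m z ->
  exists t, carried 0 s t /\ t *m D + bd K r s *m t = z.
Proof.
move=> sX hz zD.
have [i j _|t [ht tP]] := @reduce_card #|U|.+1 s z hz zD.
  by rewrite addnS ltnS (leq_trans (max_card _)) ?leq_addl.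
have [|||t' [ht' t'P]] := @reduce_colors s (defect s z t) (enum (G :\: s)).
- exact: carried_defect.
- exact: defect_cycle.
- by move=> w; rewrite mem_enum.
exists (t + t'); split; first exact: carriedD.
have : defect s z (t + t') = 0; last first.
  by rewrite /defect -addrA -opprD => /eqP; rewrite subr_eq0 => /eqP.
rewrite defectD; apply/matrixP => i j; rewrite [RHS]mxE.
apply/eqP/negPn/negP => nz.
have [[k /tP kd ik] colors] := t'P _ _ nz.
have [si _ _ _ _] := carried_defect (carried_defect hz ht) ht' nz.
have /subset_leq_card : col @: (G :\: s) \subset col @: (face_of i :\: s).
  by apply/subsetP => _ /imsetP[w wG ->]; apply: colors; rewrite mem_enum.
move=> le1; have := leq_trans (many_colors sX) (leq_trans le1 (leq_imset_card _ _)).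
by rewrite cardsD (setIidPr si) ltnNge leq_subLR ik kd.
Qed.

(** Every set containing [s] is a non-face, so for [v] outside [s] the matrix z e_v is still
    carried. It solves the equation because D e_v + e_v D = 1. *)
Lemma solve_nonface s z : s \notin X -> s != setT -> carried 1 s z ->
  z *m D = bd K r s *m z ->
  exists t, carried 0 s t /\ t *m D + bd K r s *m t = z.
Proof.
move=> sX sT hz zD; have [v vs] : exists v, v \notin s.
  by apply/existsP; apply: contraNT sT => /existsPn sT; apply/eqP/setP => v;
    rewrite inE; apply/negPn/sT.
exists (z *m e_ v); split.
  move=> i j /mulmx_neq0[k [/hz[si ic kX sk ik] /wedge_neq0[vk jk]]].
  have sj : s \subset face_of j by rewrite jk subsetD1 sk.
  split=> //; first by apply: contra sX => jX; apply: X_complex jX _.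
  by move: ik; rewrite addn0 addn1 (cardsD1 v (face_of k)) vk jk => -[].
rewrite mulmxA -zD -!mulmxA -mulmxDr addrC.
have := bd_wedge r_inj (1%:M : 'M[K]_N) (negbT (in_set0 v)).
by rewrite !mulmx1 => ->; rewrite mulmx1.
Qed.

Lemma setT_notin : setT \notin X.
Proof. by apply/negP => /many_colors; rewrite setDT imset0 cards0. Qed.

Definition top_unit : 'M[K]_N := delta_mx (index_of setT) (index_of setT).

Definition resolves (t : {set U} -> 'M[K]_N) s := carried 0 s (t s) /\
  t s *m D + bd K r s *m t s =
    \sum_(v | v \notin s) i_ v *m t (v |: s).

Lemma resolves_step (t : {set U} -> 'M[K]_N) s : s != setT ->
  (forall v, v \notin s -> resolves t (v |: s)) ->
  exists M, carried 0 s M /\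
    M *m D + bd K r s *m M = \sum_(v | v \notin s) i_ v *m t (v |: s).
Proof.
move=> sT tP; set z := \sum_(v | _) _.
have hz : carried 1 s z.
  rewrite /z; elim/big_ind: _ => [||v vs]; [exact: carried0|exact: carriedD|].
  move=> i j /mulmx_neq0[k [/contraction_neq0[vi ki] /(proj1 (tP v vs))[]]].
  rewrite !subUset !sub1set ki => /andP[_ sk] kc jX /andP[vj sj] kj.
  split=> //.
  + apply/subsetP => x xs; have := subsetP sk x xs.
    by rewrite !inE => /predU1P[xv|//]; rewrite -xv xs in vs.
  + apply: colorful_sub kc _; apply/subsetP => x; rewrite !inE => /andP[xs xi].
    rewrite xi orbT andbT negb_or xs andbT.
    by apply: contraNneq vi => <-.
  + by rewrite -kj cardsU1 vi addn0 addnC.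
have zD : z *m D = bd K r s *m z.
  apply/eqP; rewrite -subr_eq0; apply/eqP.
  (* Expanding [bd s] as i_v + bd_(s + v) and using the equations for s + v turns the difference
     into the sum of i_v i_u t_(s + v + u), antisymmetric in u and v. *)
  pose F v u := if [&& v \notin s, u \notin s & u != v]
    then i_ v *m (i_ u *m t (u |: (v |: s))) else 0.
  transitivity (\sum_v \sum_u F v u); last first.
    apply: alternating_sum0 => v => [u|]; last by rewrite /F eqxx !andbF.
    rewrite /F andbCA eq_sym; case: ifP; rewrite ?oppr0 // => _.
    by rewrite contraction_anti // setUCA.
  rewrite mulmx_suml mulmx_sumr -sumrB big_mkcond; apply: eq_bigr => v _ /=.
  case: ifP => vs; last by rewrite big1 // => u _; rewrite /F vs.
  rewrite bd_contraction // opprK (bd_setU1 K r vs) mulmxDl mulmxDr contraction_sqr.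
  rewrite add0r -mulmxA -mulmxDr (proj2 (tP v vs)) mulmx_sumr big_mkcond.
  apply: eq_bigr => u _ /=; rewrite /F vs !inE negb_or andbC /=.
  by case: (_ && _).
have [sX|sX] := boolP (s \in X); first exact: solve_face.
exact: solve_nonface.
Qed.

(** Start of the descending induction: no set is larger than [setT], so both sides are zero whatever
    [t] is. *)
Lemma top_unit_resolves (t : {set U} -> 'M[K]_N) : carried 0 setT top_unit /\
  top_unit *m D + bd K r setT *m top_unit =
    \sum_(v | v \notin setT) i_ v *m t (v |: setT).
Proof.
have topE i j : top_unit i j != 0 -> face_of i = setT /\ face_of j = setT.
  rewrite mxE; case: andP => [[/eqP-> /eqP->]|]; last by rewrite eqxx.
  by rewrite index_ofK.
split=> [i j /topE[-> ->]|].
  split; rewrite ?addn0 // ?setT_notin // setDv /colorful sub0set /=.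
  by rewrite imset0 !cards0.
have bdT : bd K r setT = 0 by apply: big1 => v; rewrite inE.
rewrite bdT mul0mx addr0 [RHS]big1 => [|v]; last by rewrite inE.
apply/matrixP => i j; rewrite [RHS]mxE; apply/eqP/negPn/negP.
move=> /mulmx_neq0[k [/topE[_ kT] /bd_neq0[v [_]]]].
by rewrite kT inE.
Qed.

Lemma resolution_exists n : exists t : {set U} -> 'M[K]_N, t setT = top_unit /\
  forall s, (#|~: s| < n)%N -> resolves t s.
Proof.
elim: n => [|n [t [tT tP]]]; first by exists (fun=> top_unit).
have cardU v s : v \notin s -> #|~: s| = #|~: (v |: s)|.+1.
  by move=> vs; rewrite (cardsD1 v) inE vs setCU setIC setDE.
(* Old values are kept, the sets with complement of size n get a solution, and the remaining ones
   the placeholder 0. *)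
have extend s : exists M,
    [/\ s == setT -> M = top_unit, (#|~: s| < n)%N -> M = t s &
        #|~: s| = n -> carried 0 s M /\ M *m D + bd K r s *m M =
          \sum_(v | v \notin s) i_ v *m t (v |: s)].
  have [sn|ns] := ltnP #|~: s| n.
    exists (t s); split=> [/eqP->||sn'] //; by rewrite sn' ltnn in sn.
  have [->|sT] := eqVneq s setT.
    by exists top_unit; split=> // _; exact: top_unit_resolves.
  have [sn|nsn] := eqVneq #|~: s| n; last first.
    by exists 0; split=> // /eqP; rewrite (negPf nsn).
  have [v vs|M hM] := @resolves_step t s sT.
    by apply: tP; rewrite -ltnS -cardU // sn.
  by exists M.
have [t' t'P] := fin_all_exists extend.
have t't s : (#|~: s| < n)%N -> t' s = t s by case: (t'P s).
exists t'; split; first by case: (t'P setT) => ->.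
move=> s sn.
have -> : resolves t' s <-> (carried 0 s (t' s) /\ t' s *m D + bd K r s *m t' s =
          \sum_(v | v \notin s) i_ v *m t (v |: s)).
  rewrite /resolves (eq_bigr (fun v => i_ v *m t (v |: s))) // => v vs.
  by rewrite t't // -ltnS -cardU.
move: sn; rewrite ltnS leq_eqVlt => /orP[/eqP sn|sn]; first by case: (t'P s) => _ _; apply.
by rewrite t't //; exact: tP.
Qed.

Lemma mxtrace0 n (M : 'M[K]_n) : (forall i, M i i = 0) -> \tr M = 0.
Proof. by move=> M0; apply: big1 => i _. Qed.

(** The outputs of i_u avoid [u], while the inputs of [M] contain [s] and hence [u]: no diagonal
    entry survives. *)
Lemma trace_contraction_wedge e s u v M : carried e s M -> u \in s ->
  \tr (i_ u *m (e_ v *m M)) = 0.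
Proof.
move=> hM us; apply: mxtrace0 => i; apply/eqP/negPn/negP.
move=> /mulmx_neq0[k [/contraction_neq0[ui _]]].
move=> /mulmx_neq0[l [_ /hM[_ _ _ si _]]].
by rewrite (subsetP si) in ui.
Qed.

Lemma trace_wedge_contraction e s u v M : carried e s M -> u \in s -> u != v ->
  \tr (e_ v *m (i_ u *m M)) = 0.
Proof.
move=> hM us nuv; apply: mxtrace0 => i; apply/eqP/negPn/negP.
move=> /mulmx_neq0[k [/wedge_neq0[_ ki]]].
move=> /mulmx_neq0[l [/contraction_neq0[uk _] /hM[_ _ _ si _]]].
by move: uk; rewrite ki !inE nuv (subsetP si).
Qed.

Lemma trace_resolves (t : {set U} -> 'M[K]_N) s v : v \notin s -> resolves t s ->
  (forall u, u \notin s -> resolves t (u |: s)) ->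
  \tr (t (v |: s)) = \tr (t s).
Proof.
move=> vs [hs ts] tP.
have := congr1 (fun M => \tr (e_ v *m M)) ts; rewrite mulmxDr mxtraceD /=.
(* By cyclicity D moves to the front, and D differs from [bd s] by contractions along [s], which
   contribute trace 0. The homotopy [bd_wedge] then collapses the left side to tr t_s. *)
have -> : \tr (e_ v *m (t s *m D)) = \tr (bd K r s *m (e_ v *m t s)).
  rewrite mulmxA mxtrace_mulC.
  have -> : D = bd K r s + \sum_(u in s) i_ u.
    rewrite addrC {1}/bd (bigID (mem s)) /=; congr (_ + _); apply: eq_bigl => u;
    by rewrite inE.
  rewrite mulmxDl mxtraceD [X in _ + X](_ : _ = 0) ?addr0 //.
  rewrite mulmx_suml raddf_sum /= big1 // => u us.
  exact: (trace_contraction_wedge v hs us).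
rewrite -mxtraceD bd_wedge // => ->.
(* On the right only u = v contributes, and e_v i_v = 1 - i_v e_v with the last term traceless. *)
rewrite mulmx_sumr raddf_sum (bigD1 v) //= big1 ?addr0 => [|u /andP[us nuv]].
  have := contraction_wedge_id r v (t (v |: s)).
  move/(congr1 mxtrace); rewrite mxtraceD.
  by rewrite (trace_contraction_wedge _ (proj1 (tP v vs))) ?setU11 // add0r => ->.
by apply: trace_wedge_contraction (proj1 (tP u us)) _ nuv; exact: setU11.
Qed.

Lemma resolution_contradiction : False.
Proof.
have [t [tT tP]] := resolution_exists #|U|.+1.
have {}tP s : resolves t s by apply: tP; rewrite ltnS max_card.
have trt n s : #|~: s| = n -> \tr (t s) = 1.
  elim: n s => [|n IHn] s.
    move/cards0_eq/(canRL (@setCK _)); rewrite setC0 => ->.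
    rewrite tT /mxtrace (bigD1 (index_of setT)) //= big1 => [|i /negPf ni].
      by rewrite mxE eqxx addr0.
    by rewrite mxE ni.
  move=> sn; have [v] : exists v, v \in ~: s by apply/card_gt0P; rewrite sn.
  rewrite inE => vs; rewrite -(trace_resolves vs) // IHn //.
  by move: sn; rewrite (cardsD1 v) inE vs setCU setIC setDE => -[].
have := trt _ set0 erefl; rewrite mxtrace0 => [/eqP|i].
  by rewrite eq_sym oner_eq0.
apply/eqP/negPn/negP => /(proj1 (tP set0))[_].
by rewrite setD0 => /colorfulX ->.
Qed.
End Resolution.

(** The number of colors in a subset of G is its rank in the partition matroid of [col], so this is
    the Kalai-Meshulam theorem for that matroid. *)
Lemma exists_face_missing_few_colors (K : fieldType) (U I : finType) (r : U -> nat) d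
    (X : {set {set U}}) (col : U -> I) (G : {set U}) :
  injective r -> is_complex X -> acyclic_from K r d X ->
  (forall A, colorful col G A -> A \in X) ->
  exists2 s, s \in X & (#|col @: (G :\: s)| <= d)%N.
Proof.
move=> r_inj X_complex X_acyclic colX; apply/exists_inP/contraT => /exists_inPn few.
case: (resolution_contradiction r_inj X_complex X_acyclic colX) => s sX.
by rewrite ltnNge few.
Qed.

(** * The blow-up of C and its rainbow sets *)

Lemma is_leray_le (R : nzRingType) (V : finType) (C : {set {set V}}) d :
  (leray_number R C <= d)%N -> is_leray R C d.
Proof.
rewrite /leray_number; case: ex_minnP => n /boolp.asboolP Cn _ nd S j dj.
exact: Cn (leq_trans nd dj).
Qed.

Lemma exists_subset_card (T : finType) (A : {set T}) n : (n <= #|A|)%N ->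
  exists2 B : {set T}, B \subset A & #|B| = n.
Proof.
move=> nA; exists [set x in take n (enum A)].
  by apply/subsetP => x; rewrite inE => /mem_take; rewrite mem_enum.
rewrite cardsE (card_uniqP _) ?take_uniq ?enum_uniq // size_takel //.
by rewrite -cardE.
Qed.

Section ColoredVertices.
Variables (V : finType) (m : nat) (S : 'I_m -> {set V}).

(** The V-coordinate comes first so that [fst] is monotone, as the signs in [acyclic_preim]
    require. *)
Definition lex_rank (p : V * 'I_m) : nat := (enum_rank p.1 * m + p.2)%N.

Lemma lex_rank_mono p q :
  (enum_rank p.1 < enum_rank q.1)%N -> (lex_rank p < lex_rank q)%N.
Proof.
move=> pq; apply: (@leq_trans ((enum_rank p.1).+1 * m)).
  by rewrite /lex_rank mulSn addnC -addSn leq_add2r ltn_ord.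
by apply: leq_trans (leq_addr _ _); rewrite leq_mul2r pq orbT.
Qed.

Lemma lex_rank_inj : injective lex_rank.
Proof.
move=> p q pq; have pq1 : p.1 = q.1.
  apply: enum_rank_inj; apply: val_inj; case: (ltngtP (enum_rank p.1) (enum_rank q.1)) => //.
  - by move/lex_rank_mono; rewrite pq ltnn.
  - by move/lex_rank_mono; rewrite pq ltnn.
move: pq; rewrite /lex_rank pq1 => /addnI/val_inj.
by case: p q pq1 => [x i] [y j] /= -> ->.
Qed.

Definition choices := [set p : V * 'I_m | p.1 \in S p.2].

Lemma colorful_rainbow A : colorful snd choices A -> is_rainbow S (fst @: A).
Proof.
case/andP=> AG /imset_injP Ainj; exists (fun i => [pick x | (x, i) \in A]).
  move=> i x; case: pickP => // y yA [<-].
  by have := subsetP AG _ yA; rewrite inE.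
apply/setP => x; rewrite inE; apply/imsetP/existsP.
  case=> -[y i] yA /= ->; exists i; case: pickP => [z zA|/(_ y)]; last by rewrite yA.
  by have [->] := Ainj _ _ zA yA erefl.
by case=> i; case: pickP => // y yA /eqP[<-]; exists (y, i).
Qed.

End ColoredVertices.

Local Close Scope ring_scope.

Theorem theorem1p5 (R : idomainType) (V : finType) (C : {set {set V}})
    (d k : nat) (S : 'I_(d + k) -> {set V})
    (C_complex : is_complex C)
    (C_leray : leray_number R C <= d)
    (S_unions : forall I : {set 'I_(d + k)},
       #|I| = k -> \bigcup_(i in I) S i \notin C) :
  exists A : {set V}, is_rainbow S A /\ A \notin C.
Proof.
apply: boolp.contrapT => no_rainbow.
pose X := [set A : {set V * 'I_(d + k)} | fst @: A \in C].
have X_complex : is_complex X.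
  move=> A B; rewrite !inE => fA BA; apply: C_complex fA _; exact: imsetS.
have rank_inj : injective (fun v : V => enum_rank v : nat).
  by move=> u v /val_inj/enum_rank_inj.
have X_acyclic : acyclic_from {fraction R} (@lex_rank V (d + k)) d X.
  apply: (acyclic_preim (@lex_rank_inj V _) rank_inj (@lex_rank_mono V _)) => //.
  exact/leray_acyclic/is_leray_le.
have [A A_colorful|s] := exists_face_missing_few_colors (col := snd) (G := choices S)
  (@lex_rank_inj V _) X_complex X_acyclic.
  rewrite inE; apply/negPn/negP => fA; apply: no_rainbow.
  by exists (fst @: A); split=> //; exact: colorful_rainbow.
rewrite inE => sC few.
(* At most d colors are left outside [s], so at least k indices i have all their pairs (v, i) inside
   [s]. The union of the S_i over k of them lies in the projection of [s], a face of C. *)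
have [J Js Jk] : exists2 J : {set 'I_(d + k)},
    J \subset ~: (snd @: (choices S :\: s)) & #|J| = k.
  apply: exists_subset_card.
  rewrite -(leq_add2l d) -[X in X <= _](card_ord (d + k)).
  by rewrite -(cardsC (snd @: (choices S :\: s))) leq_add2r.
case/negP: (S_unions J Jk); apply: C_complex sC _.
apply/bigcupsP => i /(subsetP Js); rewrite inE => ni.
apply/subsetP => v vi; apply/imsetP; exists (v, i) => //.
by apply: contraNT ni => vis; apply/imsetP; exists (v, i); rewrite // !inE vis.
Qed.
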